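(* As formal power series, $$\sum_{\pi \in I(3412)} q^{inv(\pi)} x^{|\pi|} = \cfrac{1}{1-x - \cfrac{x^2 q}{1-x q^2 - \cfrac{x^2 q^5}{1 - xq^4 - \cdots}}},$$ where the continued fraction on the right has the form $\cfrac{1}{b_0 - \cfrac{a_1}{b_1 - \cfrac{a_2}{b_2 - \cdots}}}$ with $b_0 = 1-x$ and, for all $n\ge 1$, $a_n = x^2 q^{4n-3}$ and $b_n = 1 - xq^{2n}$.
   Context: $I(3412)$ denotes the set of all involutions (of all lengths $n\ge 0$, including the empty permutation), in one-line notation, which avoid $3412$, i.e. have no subsequence in the same relative order as $3412$. $|\pi|$ is the length of $\pi$, and $inv(\pi)$ is the number of inversions of $\pi$. The infinite continued fraction is the formal-power-series limit of its finite truncations. *)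

(* Defs.v *)
From HB Require Import structures.
From mathcomp Require Import all_boot all_order all_algebra all_fingroup.
From mathcomp Require Import boolp.

Set Implicit Arguments.
Unset Strict Implicit.
Unset Printing Implicit Defensive.

Import GRing.Theory.
Local Open Scope ring_scope.

(* fps R is R[[X]]; f n is the coefficient of X^n in f *)
Record fps (R : Type) := Fps { coefps :> nat -> R }.

Lemma fpsP (R : Type) (f g : fps R) : f =1 g -> f = g.
Proof. by case: f g => [f] [g] /= /funext ->. Qed.

HB.instance Definition _ (R : Type) := gen_eqMixin (fps R).
HB.instance Definition _ (R : Type) := gen_choiceMixin (fps R).

Section FpsRing.
Variable R : comNzRingType.
Implicit Types f g h : fps R.

Definition fpsC (c : R) : fps R := Fps (fun n => if n == 0%N then c else 0).
Definition fpsX : fps R := Fps (fun n => (n == 1%N)%:R).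

Definition fps_zero : fps R := Fps (fun=> 0).
Definition fps_opp f : fps R := Fps (fun n => - f n).
Definition fps_add f g : fps R := Fps (fun n => f n + g n).

Fact fps_addA : associative fps_add.
Proof. by move=> f g h; apply: fpsP => n /=; rewrite addrA. Qed.
Fact fps_addC : commutative fps_add.
Proof. by move=> f g; apply: fpsP => n /=; rewrite addrC. Qed.
Fact fps_add0 : left_id fps_zero fps_add.
Proof. by move=> f; apply: fpsP => n /=; rewrite add0r. Qed.
Fact fps_addN : left_inverse fps_zero fps_opp fps_add.
Proof. by move=> f; apply: fpsP => n /=; rewrite addNr. Qed.

HB.instance Definition _ :=
  Algebra.isZmodule.Build (fps R) fps_addA fps_addC fps_add0 fps_addN.

Definition fps_one : fps R := fpsC 1.
Definition fps_mul f g : fps R :=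
  Fps (fun n => \sum_(i < n.+1) f i * g (n - i)%N).

Definition fps_trunc m f : {poly R} := \poly_(i < m) f i.

Lemma fps_mul_trunc f g m n : (n < m)%N ->
  fps_mul f g n = (fps_trunc m f * fps_trunc m g)`_n.
Proof.
move=> ltnm; rewrite coefM; apply: eq_bigr => i _.
have lei : (i <= n)%N by rewrite -ltnS.
by rewrite !coef_poly (leq_ltn_trans lei ltnm) (leq_ltn_trans (leq_subr i n)).
Qed.

Fact fps_mulC : commutative fps_mul.
Proof.
by move=> f g; apply: fpsP => n; rewrite !(@fps_mul_trunc _ _ n.+1) // mulrC.
Qed.

Fact fps_mulA : associative fps_mul.
Proof.
move=> f g h; apply: fpsP => n; pose t := fps_trunc n.+1.
transitivity (t f * (t g * t h))`_n.
  rewrite coefM; apply: eq_bigr => i _.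
  rewrite coef_poly ltn_ord -(@fps_mul_trunc _ _ n.+1) //.
  by rewrite ltnS leq_subr.
rewrite mulrA coefM; apply: eq_bigr => i _.
by rewrite -(@fps_mul_trunc _ _ n.+1) ?ltn_ord // coef_poly ltnS leq_subr.
Qed.

Fact fps_mul1 : left_id fps_one fps_mul.
Proof.
move=> f; apply: fpsP => n /=; rewrite big_ord_recl /= mul1r subn0.
by rewrite big1 ?addr0 // => i _; rewrite mul0r.
Qed.

Fact fps_mulDl : left_distributive fps_mul fps_add.
Proof.
move=> f g h; apply: fpsP => n /=; rewrite -big_split /=.
by apply: eq_bigr => i _; rewrite mulrDl.
Qed.

Fact fps_one_neq0 : fps_one != fps_zero.
Proof.
apply/eqP => /(congr1 (fun f : fps R => f 0%N)) /= /eqP.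
by rewrite oner_eq0.
Qed.

HB.instance Definition _ := GRing.Zmodule_isComNzRing.Build (fps R)
  fps_mulA fps_mulC fps_mul1 fps_mulDl fps_one_neq0.

Lemma coef_fps0 n : (0 : fps R) n = 0. Proof. by []. Qed.
Lemma coef_fpsD f g n : (f + g) n = f n + g n. Proof. by []. Qed.
Lemma coef_fpsN f n : (- f) n = - f n. Proof. by []. Qed.
Lemma coef_fps1 n : (1 : fps R) n = (n == 0%N)%:R.
Proof. by case: n. Qed.
Lemma coef_fpsM f g n : (f * g) n = \sum_(i < n.+1) f i * g (n - i)%N.
Proof. by []. Qed.
Lemma coef_fps0M f g : (f * g) 0%N = f 0%N * g 0%N.
Proof. by rewrite coef_fpsM big_ord1. Qed.

Lemma coef_fps_sum I (r : seq I) (P : pred I) (F : I -> fps R) n :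
  (\sum_(i <- r | P i) F i) n = \sum_(i <- r | P i) F i n.
Proof. by apply: (big_morph (fun f : fps R => f n)). Qed.

Lemma coef_fpsCM c f n : (fpsC c * f) n = c * f n.
Proof.
rewrite coef_fpsM big_ord_recl /= subn0 big1 ?addr0 // => i _.
by rewrite mul0r.
Qed.

Lemma coef_fpsXM f n : (fpsX * f) n = if n is n'.+1 then f n' else 0.
Proof.
case: n => [|n]; first by rewrite coef_fps0M /= mul0r.
rewrite coef_fpsM 2!big_ord_recl /= mul0r add0r mul1r subSS subn0.
by rewrite big1 ?addr0 // => i _; rewrite mul0r.
Qed.

Lemma coef_fpsXn k n : (fpsX ^+ k) n = (n == k)%:R.
Proof.
elim: k n => [|k IHk] n; first by rewrite expr0 coef_fps1.
by rewrite exprS coef_fpsXM; case: n.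
Qed.

End FpsRing.

Section FpsUnit.
Variable R : comUnitRingType.
Implicit Types f g : fps R.

(* A series is invertible iff its constant term is; the coefficients of the
   inverse g are g_0 = f_0^-1 and g_n = - f_0^-1 sum_(i < n) f_(n-i) g_i. *)
Definition fps_unit : {pred fps R} := fun f => f 0%N \is a GRing.unit.

Fixpoint fps_inv_seq f n : seq R :=
  if n is n'.+1 then
    let s := fps_inv_seq f n' in
    rcons s (if n' == 0%N then (f 0%N)^-1
             else - (f 0%N)^-1 * \sum_(i < n') f (n' - i)%N * s`_i)
  else [::].

Definition fps_inv f : fps R :=
  if f \in fps_unit then Fps (fun n => (fps_inv_seq f n.+1)`_n) else f.

Lemma size_fps_inv_seq f n : size (fps_inv_seq f n) = n.
Proof. by elim: n => //= n IHn; rewrite size_rcons IHn. Qed.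

Lemma nth_fps_inv_seq f m n : (n < m)%N ->
  (fps_inv_seq f m)`_n = (fps_inv_seq f n.+1)`_n.
Proof.
elim: m => // m IHm; rewrite ltnS leq_eqVlt => /predU1P[-> //|ltnm].
by rewrite [in LHS]/= nth_rcons size_fps_inv_seq ltnm IHm.
Qed.

Fact fps_mulVx : {in fps_unit, left_inverse 1 fps_inv *%R}.
Proof.
move=> f Uf; apply: fpsP => n; rewrite mulrC coef_fpsM coef_fps1.
rewrite /fps_inv Uf /=.
case: n => [|n]; first by rewrite big_ord1 /= divrr.
rewrite big_ord_recl subn0 nth_rcons size_rcons size_fps_inv_seq ltnn eqxx /=.
rewrite mulrA mulrN divrr // mulN1r; apply/eqP; rewrite addrC subr_eq0.
rewrite [eqbRHS](reindex_inj rev_ord_inj) /=; apply/eqP/eq_bigr => i _.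
have lei : (i <= n)%N by rewrite -ltnS.
rewrite /bump add1n !subSS subSn ?leq_subr // subKn //; congr (_ * _).
by apply/esym/(@nth_fps_inv_seq f n.+1 (n - i)); rewrite ltnS leq_subr.
Qed.

Fact fps_unitPl f g : g * f = 1 -> fps_unit f.
Proof.
move/(congr1 (fun h : fps R => h 0%N)); rewrite coef_fps0M coef_fps1 => gf1.
by apply/unitrP; exists (g 0%N); rewrite [f 0%N * _]mulrC gf1.
Qed.

Fact fps_invr_out : {in [predC fps_unit], fps_inv =1 id}.
Proof. by move=> f /negbTE nUf; rewrite /fps_inv nUf. Qed.

HB.instance Definition _ := GRing.ComNzRing_hasMulInverse.Build (fps R)
  fps_mulVx fps_unitPl fps_invr_out.

Lemma fps_unitE f : (f \is a GRing.unit) = (f 0%N \is a GRing.unit).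
Proof. by []. Qed.

End FpsUnit.

(* Z[[q, x]], encoded as Z[[q]][[x]]: F n m is the coefficient of x^n q^m *)
Definition Zqx : comUnitRingType := fps (fps int).
Definition qvar : Zqx := fpsC (fpsX int).
Definition xvar : Zqx := fpsX (fps int).

(* coefficientwise convergence: each coefficient is eventually constant *)
Definition Zqx_cvg (F : nat -> Zqx) (L : Zqx) : Prop :=
  forall n m, exists N, forall k, (N <= k)%N -> F k n m = L n m.

(* cf_denom a b k j = b_j - a_(j+1) / (b_(j+1) - ... - a_(j+k) / b_(j+k)).
   Division is total in a unitRingType (y^-1 = y for a non-unit y). *)
Fixpoint cf_denom (A : unitRingType) (a b : nat -> A) (k j : nat) : A :=
  if k is k'.+1 then b j - a j.+1 / cf_denom a b k' j.+1 else b j.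

Definition cf_convergent (A : unitRingType) (a b : nat -> A) (k : nat) : A :=
  1 / cf_denom a b k 0.

(* Every denominator that occurs in cf_convergent is a genuine unit as soon as
   the a_i have constant term 0 and the b_i have a unit as constant term. *)
Lemma cf_denom_unit (R : comUnitRingType) (a b : nat -> fps R) k j :
    (forall i, a i.+1 0%N = 0) -> (forall i, b i 0%N \is a GRing.unit) ->
  cf_denom a b k j \is a GRing.unit.
Proof.
move=> a0 bU; case: k => [|k] /=; rewrite fps_unitE; first exact: bU.
by rewrite coef_fpsD coef_fpsN coef_fps0M a0 mul0r subr0.
Qed.

Definition involution n (s : 'S_n) : bool := [forall i, s (s i) == i].

Definition inv n (s : 'S_n) : nat :=
  #|[set p : 'I_n * 'I_n | (p.1 < p.2)%N && (s p.2 < s p.1)%N]|.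

(* f lists the positions of a subsequence of s(0) s(1) ... s(n-1) in the same
   relative order as the word p, whose letters are assumed distinct. *)
Definition occurrence (p : seq nat) n (s : 'S_n)
    (f : {ffun 'I_(size p) -> 'I_n}) : bool :=
  [forall i : 'I_(size p), forall j : 'I_(size p),
     ((i < j)%N ==> (f i < f j)%N) &&
     ((s (f i) < s (f j))%N == (nth 0%N p i < nth 0%N p j)%N)].

Definition avoids (p : seq nat) n (s : 'S_n) : bool :=
  ~~ [exists f, @occurrence p n s f].

Definition I3412 n : {set 'S_n} :=
  [set s | involution s && avoids [:: 3; 4; 1; 2]%N s].

(* The formal sum of q^inv(s) x^n over all n and all s in I3412 n, grouped by
   powers of x; I3412_gfE below checks that it is the limit of its finite
   partial sums. *)
Definition I3412_gf : Zqx :=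
  Fps (fun n => \sum_(s in I3412 n) fpsX int ^+ inv s).

Lemma I3412_gfE :
  Zqx_cvg (fun N => \sum_(n < N) \sum_(s in I3412 n) qvar ^+ inv s * xvar ^+ n)
          I3412_gf.
Proof.
have qE k : qvar ^+ k = fpsC (fpsX int ^+ k).
  elim: k => [|k IHk]; first by rewrite !expr0.
  rewrite !exprS IHk; apply: fpsP => n; rewrite coef_fpsCM /=.
  by case: ifP => // _; rewrite mulr0.
move=> n m; exists n.+1 => k ltnk; congr (coefps _ m).
rewrite coef_fps_sum (bigD1 (Ordinal ltnk)) //= [X in _ + X]big1 ?addr0.
  rewrite coef_fps_sum; apply: eq_bigr => s _.
  by rewrite qE coef_fpsCM coef_fpsXn eqxx mulr1.
move=> i neq_in; rewrite coef_fps_sum big1 // => s _.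
rewrite qE coef_fpsCM coef_fpsXn; case: eqP => [eq_ni|]; last by rewrite mulr0.
by case/eqP: neq_in; apply: val_inj; rewrite /= eq_ni.
Qed.

(* Main.v *)
Require Import Defs.
From mathcomp Require Import all_boot all_order all_algebra all_fingroup.
From mathcomp Require Import zify ring.
Import GRing.Theory.
Local Open Scope ring_scope.

Set Implicit Arguments.
Unset Strict Implicit.
Unset Printing Implicit Defensive.

(** The one-line word of an involution contains 3412 exactly when two of its
    arcs i -- s i and j -- s j cross, i < j < s i < s j.  So the left-hand side
    enumerates systems of noncrossing arcs and fixed points on n points.  In
    such a system the number of inversions is local: an arc is one inversion,
    and every arc adds two inversions for each point that it covers
    ([inv_join]).

    Let g n ([wt] below) be the sum of q^inv(s) over these systems on n points.
    The first of n + 1 points is either fixed, or joined to a later point; in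
    that case the arc separates the i points that it covers from the n - 1 - i
    points to its right, whence ([wtS])
      g (n+1) = g n + sum_(i < n) q^(2i+1) * g i * g (n - 1 - i).
    To avoid relabelling points, all systems live in one symmetric group 'S_n
    and are supported in an interval [l, r); the decomposition is then a
    product of permutations ([weight_rec]), and g is well defined because the
    sum over an interval depends on its length only ([weight_shift]).

    Put F_j = sum_n q^(2jn) g n x^n, the series of the systems nested inside j
    further arcs.  The recurrence says
      F_j = 1 + x q^(2j) F_j + x^2 q^(4j+1) F_(j+1) F_j,
    that is F_j = 1 / (b_j - a_(j+1) F_(j+1)).  Truncating the fraction after
    k steps only affects systems in which k + 1 arcs are nested, so the
    coefficients of degree at most k are already final ([coef_denom_inv]). *)

(** * Noncrossing involutions *)

Definition noncrossing n (s : 'S_n) : bool :=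
  [forall i : 'I_n, forall j : 'I_n,
     ~~ [&& (i < j)%N, (j < s i)%N & (s i < s j)%N]].

Lemma noncrossingP n (s : 'S_n) :
  reflect (forall i j : 'I_n, (i < j)%N -> (j < s i)%N -> (s i < s j)%N -> False)
          (noncrossing s).
Proof.
apply: (iffP forallP) => [H i j ij ji ss | H i].
  by move/forallP: (H i) => /(_ j); rewrite ij ji ss.
by apply/forallP => j; apply/negP => /and3P[]; exact: H.
Qed.

(** A crossing i < j < s i < s j gives the word s i, s j, i, j at these four
    positions.  Conversely, let positions a < b < c < d carry 3412.  If
    b < s a, the arcs at a and b cross; otherwise s c < s d < s a <= b < c < d,
    and the arcs s c -- c and s d -- d cross. *)
Lemma avoids3412_noncrossing n (s : 'S_n) :
  involution s -> avoids [:: 3; 4; 1; 2]%N s = noncrossing s.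
Proof.
move=> /forallP sK; have {}sK i : s (s i) = i by apply/eqP.
apply/idP/noncrossingP => [Av i j ij ji ss | Nc].
  case/existsP: Av.
  exists [ffun k : 'I_(size [:: 3; 4; 1; 2]%N) => nth i [:: i; j; s i; s j] k].
  apply/forallP => -[[|[|[|[|//]]]] ?]; apply/forallP => -[[|[|[|[|//]]]] ?];
    rewrite !ffunE /= ?sK; lia.
apply/existsP => -[f /forallP occ].
pose p (k : nat) (lt_k : (k < 4)%N) : 'I_(size [:: 3; 4; 1; 2]%N) := Ordinal lt_k.
have occE u v := elimT andP (elimT forallP (occ u) v).
pose a := f (@p 0 isT); pose b := f (@p 1 isT).
pose c := f (@p 2 isT); pose d := f (@p 3 isT).
have [/= ab _] := occE (@p 0 isT) (@p 1 isT).
have [/= bc _] := occE (@p 1 isT) (@p 2 isT).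
have [/= cd /eqP/= scd] := occE (@p 2 isT) (@p 3 isT).
have [/= _ /eqP/= sda] := occE (@p 3 isT) (@p 0 isT).
have [/= _ /eqP/= sab] := occE (@p 0 isT) (@p 1 isT).
rewrite -/a -/b -/c -/d in ab bc cd scd sda sab.
have [le_ab | lt_ba] := leqP (s a) b.
  by apply: (Nc (s c) (s d)); rewrite ?sK; lia.
by apply: (Nc a b); lia.
Qed.

(** The bounds l and r are arbitrary naturals: the ambient group 'S_n stays the
    same when a system of arcs is cut into pieces. *)
Definition ncinvol n (l r : nat) : {set 'S_n} :=
  [set s | [&& involution s, noncrossing s
             & [forall i : 'I_n, (l <= i < r)%N || (s i == i)]]].

Lemma ncinvolP n l r (s : 'S_n) :
  reflect [/\ forall i, s (s i) = i,
              forall i j : 'I_n, (i < j)%N -> (j < s i)%N -> (s i < s j)%N -> False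
            & forall i : 'I_n, ~~ (l <= i < r)%N -> s i = i]
          (s \in ncinvol n l r).
Proof.
rewrite inE; apply: (iffP and3P) =>
  [[/forallP sK /noncrossingP nc /forallP sF]|[sK nc sF]].
  split=> // i; first exact/eqP.
  by move=> ni; move: (sF i); rewrite (negPf ni) => /eqP.
split; first by apply/forallP => i; apply/eqP.
  exact/noncrossingP.
by apply/forallP => i; case: (boolP (l <= i < r)%N) => //= /sF ->.
Qed.

Lemma I3412_ncinvol n : I3412 n = ncinvol n 0 n.
Proof.
apply/setP => s; rewrite !inE.
have -> : [forall i : 'I_n, (0 <= i < n)%N || (s i == i)].
  by apply/forallP => i; rewrite ltn_ord.
by rewrite andbT; apply: andb_id2l => /avoids3412_noncrossing.
Qed.

Lemma ncinvol_stable n l r (s : 'S_n) (i : 'I_n) :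
  s \in ncinvol n l r -> (l <= i < r)%N -> (l <= s i < r)%N.
Proof.
case/ncinvolP => sK _ sF hi; apply: contraLR (hi) => hsi.
by have := sF _ hsi; rewrite sK => ->.
Qed.

Lemma ncinvol_nil n l : ncinvol n l l = [set 1%g].
Proof.
apply/setP => s; rewrite [RHS]inE; apply/ncinvolP/eqP => [[_ _ sF]|->].
  by apply/permP => i; rewrite perm1 sF //; lia.
by split=> [i|i j|i]; rewrite !perm1 //; lia.
Qed.

Lemma restr_permP (T : finType) (A : {set T}) (s : {perm T}) (i : T) :
  (forall x, x \in A -> s x \in A) ->
  restr_perm A s i = if i \in A then s i else i.
Proof.
move=> sA; case: ifPn => iA; last exact: out_perm (restr_perm_on A s) iA.
apply: restr_permE => //; rewrite !inE /=; apply/subsetP => x xA.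
by rewrite !inE /= sA.
Qed.

(** * Removing the outer arc at the first point *)

Section Arc.
Variables (n : nat) (a c : 'I_n) (r : nat).
Hypotheses (lt_ac : (a < c)%N) (lt_cr : (c < r)%N).

Definition join (t : 'S_n * 'S_n) : 'S_n := (tperm a c * t.1 * t.2)%g.

Definition split_arc (s : 'S_n) : 'S_n * 'S_n :=
  (restr_perm [set i : 'I_n | (a < i < c)%N] s,
   restr_perm [set i : 'I_n | (c < i < r)%N] s).

(** The supports of s1, of s2 and of the transposition are disjoint, so the
    product agrees with exactly one factor at each point.  The last case merges
    the right-hand block with the points outside [a, r), which s2 fixes. *)
Lemma joinP (s1 s2 : 'S_n) (i : 'I_n) (h := join (s1, s2)) :
    s1 \in ncinvol n a.+1 c -> s2 \in ncinvol n c.+1 r ->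
  [\/ i = a /\ h i = c, i = c /\ h i = a,
      [/\ (a < i < c)%N, h i = s1 i, s2 i = i & (a < s1 i < c)%N]
   |  [/\ ~~ (a <= i <= c)%N, h i = s2 i, s1 i = i &
          (c < i < r /\ c < s2 i < r)%N \/ ~~ (c < i < r)%N /\ s2 i = i]].
Proof.
move=> s1P s2P; have hE x : h x = s2 (s1 (tperm a c x)) by rewrite !permM.
have st1 := ncinvol_stable s1P; have st2 := ncinvol_stable s2P.
case/ncinvolP: s1P => _ _ F1; case/ncinvolP: s2P => _ _ F2.
case: (eqVneq i a) => [->|ia].
  by apply: Or41; rewrite hE tpermL F1 ?F2 //; lia.
case: (eqVneq i c) => [->|ic].
  by apply: Or42; rewrite hE tpermR F1 ?F2 //; lia.
move: (ia) (ic); rewrite -!val_eqE /= => va vc.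
rewrite hE tpermD 1?eq_sym //.
have [hi|hi] := boolP (a < i < c)%N.
  have hsi := st1 _ hi; apply: Or43; split=> //; rewrite F2 //; lia.
apply: Or44; rewrite F1 //; split=> //; first lia.
have [hj|hj] := boolP (c < i < r)%N; [left | right]; split=> //.
  exact: st2.
exact: F2.
Qed.

Lemma join_first (s1 s2 : 'S_n) :
    s1 \in ncinvol n a.+1 c -> s2 \in ncinvol n c.+1 r ->
  join (s1, s2) a = c.
Proof.
move=> s1P s2P; case: (joinP a s1P s2P) => [[_ ->]|[e]|[]|[]] //; last by lia.
  by move: lt_ac; rewrite ?e; lia.
by lia.
Qed.

Lemma join_last (s1 s2 : 'S_n) :
    s1 \in ncinvol n a.+1 c -> s2 \in ncinvol n c.+1 r ->
  join (s1, s2) c = a.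
Proof.
move=> s1P s2P; case: (joinP c s1P s2P) => [[e]|[_ ->]|[]|[]] //; try by lia.
by move: lt_ac; rewrite -?e; lia.
Qed.

Lemma join_ncinvol (s1 s2 : 'S_n) :
    s1 \in ncinvol n a.+1 c -> s2 \in ncinvol n c.+1 r ->
  join (s1, s2) \in ncinvol n a r.
Proof.
move=> s1P s2P; have hP i := joinP i s1P s2P.
case/ncinvolP: (s1P) => K1 N1 F1; case/ncinvolP: (s2P) => K2 N2 F2.
apply/ncinvolP; split.
- move=> i; case: (hP i) => [[-> ->]|[-> ->]|[hi -> _ hs]|[hi -> _ hs]].
  + exact: join_last.
  + exact: join_first.
  + by case: (hP (s1 i)) hs => [[-> _]|[-> _]|[_ -> _ _]|[]];
      rewrite ?K1 //; move=> *; exfalso; lia.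
  + case: hs => [[_ hs]|[_ e]].
      by case: (hP (s2 i)) hs => [[-> _]|[-> _]|[]|[_ -> _ _]];
        rewrite ?K2 //; move=> *; exfalso; lia.
    rewrite e; case: (hP i) => [[e' _]|[e' _]|[hi' _ _ _]|[_ -> _ _]] //;
      move: hi; rewrite ?e'; lia.
- move=> i j; move: (N1 i j) (N2 i j).
  case: (hP i) => [[-> ->]|[-> ->]|[hi -> _ hs]|[hi -> _ [[_ hs]|[hs ->]]]];
  case: (hP j) => [[-> ->]|[-> ->]|[hj -> _ ht]|[hj -> _ [[_ ht]|[ht ->]]]] //
    NN1 NN2 ij jh hh;
  by (lia || exact: NN1 || exact: NN2).
- move=> i hi; case: (hP i) => [[e]|[e]|[]|[_ -> _ [[]|[]]]] //;
    move: hi; rewrite ?e; lia.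
Qed.

Lemma ncinvol_off_arc (s : 'S_n) (i : 'I_n) :
    s \in ncinvol n a r -> s a = c -> val i != val a -> val i != val c ->
  val (s i) != val a /\ val (s i) != val c.
Proof.
case/ncinvolP=> sK _ _ sa ia ic; split.
  by apply: contra ic => /eqP/val_inj/(congr1 s); rewrite sK sa => ->.
by apply: contra ia => /eqP/val_inj; rewrite -{1}sa => /perm_inj ->.
Qed.

(** A point under the arc a -- c cannot be joined to a point after c without
    crossing that arc. *)
Lemma ncinvol_enclosed (s : 'S_n) (i : 'I_n) :
  s \in ncinvol n a r -> s a = c -> (a < i < c)%N -> (a < s i < c)%N.
Proof.
move=> sP sa hi.
have [ia ic] : val i != val a /\ val i != val c by split; rewrite /=; lia.
have [sia sic] := ncinvol_off_arc sP sa ia ic.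
have := ncinvol_stable (i := i) sP.
case/ncinvolP: sP => sK nc _.
by have := nc a i; move: sia sic; rewrite /= sa; lia.
Qed.

Lemma ncinvol_right (s : 'S_n) (i : 'I_n) :
  s \in ncinvol n a r -> s a = c -> (c < i < r)%N -> (c < s i < r)%N.
Proof.
move=> sP sa hi.
have [ia ic] : val i != val a /\ val i != val c by split; rewrite /=; lia.
have [sia sic] := ncinvol_off_arc sP sa ia ic.
have := ncinvol_stable (i := i) sP.
have := ncinvol_enclosed (i := s i) sP sa.
case/ncinvolP: sP => sK nc _; rewrite sK.
by move: sia sic; rewrite /=; lia.
Qed.

Lemma split_arcE (s : 'S_n) (i : 'I_n) : s \in ncinvol n a r -> s a = c ->
  ((split_arc s).1 i = if (a < i < c)%N then s i else i) *
  ((split_arc s).2 i = if (c < i < r)%N then s i else i).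
Proof.
move=> sP sa; split; rewrite restr_permP ?inE // => x; rewrite !inE.
  exact: ncinvol_enclosed.
exact: ncinvol_right.
Qed.

Lemma split_arc_ncinvol (s : 'S_n) (t := split_arc s) :
  s \in ncinvol n a r -> s a = c ->
  (t.1 \in ncinvol n a.+1 c) && (t.2 \in ncinvol n c.+1 r).
Proof.
move=> sP sa; have tE i := split_arcE i sP sa.
have s1 i := ncinvol_enclosed (i := i) sP sa.
have s2 i := ncinvol_right (i := i) sP sa.
case/ncinvolP: sP => sK nc _.
apply/andP; split; apply/ncinvolP; split=> [i|i j|i]; rewrite !tE.
- by case: (boolP (a < i < c)%N) => [/s1 ->|/negPf ->].
- by have := nc i j; have := s1 i; have := s1 j; do 2!case: ifP; lia.
- by move/negPf ->.
- by case: (boolP (c < i < r)%N) => [/s2 ->|/negPf ->].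
- by have := nc i j; have := s2 i; have := s2 j; do 2!case: ifP; lia.
- by move/negPf ->.
Qed.

Lemma split_arcK (s : 'S_n) :
  s \in ncinvol n a r -> s a = c -> join (split_arc s) = s.
Proof.
move=> sP sa; apply/permP => i; have /andP[t1P t2P] := split_arc_ncinvol sP sa.
have tE := split_arcE i sP sa.
case/ncinvolP: (sP) => sK _ sF.
rewrite [split_arc s]surjective_pairing.
case: (joinP i t1P t2P) => [[-> ->]|[-> ->]|[hi -> _ _]|[hi -> _ _]] //.
- by rewrite -sa sK.
- by rewrite tE hi.
- by rewrite tE; case: ifP => // hj; rewrite sF //; lia.
Qed.

Lemma joinK (s1 s2 : 'S_n) :
    s1 \in ncinvol n a.+1 c -> s2 \in ncinvol n c.+1 r ->
  join (s1, s2) a = c /\ split_arc (join (s1, s2)) = (s1, s2).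
Proof.
move=> s1P s2P; have hP i := joinP i s1P s2P.
have ha := join_first s1P s2P; split=> //.
have tE i := split_arcE i (join_ncinvol s1P s2P) ha.
case/ncinvolP: (s1P) => _ _ F1; case/ncinvolP: (s2P) => _ _ F2.
rewrite [LHS]surjective_pairing; congr (_, _); apply/permP => i; rewrite tE.
  case: ifPn => [hi|hi]; last by rewrite F1.
  by case: (hP i) => [[e]|[e]|[]|[]] //; move: hi; rewrite ?e; lia.
case: ifPn => [hi|hi]; last by rewrite F2.
by case: (hP i) => [[e]|[e]|[]|[]] //; move: hi; rewrite ?e; lia.
Qed.

End Arc.

(** * Inversions *)

Lemma invE n (s : 'S_n) :
  Defs.inv s = (\sum_(i < n) \sum_(j < n) ((i < j) && (s j < s i)))%N.
Proof.
rewrite /Defs.inv -sum1dep_card pair_big big_mkcond /=.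
by apply: eq_bigr => p _; case: ifP.
Qed.

Lemma sum_itv n l r : (l <= r <= n)%N -> (\sum_(i < n) (l <= i < r) = r - l)%N.
Proof.
move=> lrn; transitivity (minn r n - minn l n)%N; last by lia.
have {lrn} : (l <= r)%N by lia.
elim: n => [|n IHn] lr; first by rewrite big_ord0; lia.
by rewrite big_ord_recr /= IHn //; lia.
Qed.

(** The arc a -- c is inverted with each of the c - a - 1 points between its
    endpoints twice, once at either end, and its endpoints form one inversion:
    2(c - a - 1) + 1 in all.  The remaining inversions are those of s1 and s2,
    as these fix everything else and preserve their blocks. *)
Lemma inv_join n (a c : 'I_n) r (s1 s2 : 'S_n) : (a < c)%N -> (c < r)%N ->
    s1 \in ncinvol n a.+1 c -> s2 \in ncinvol n c.+1 r ->
  Defs.inv (join a c (s1, s2)) =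
  ((c - a.+1).*2.+1 + Defs.inv s1 + Defs.inv s2)%N.
Proof.
move=> ac cr s1P s2P; rewrite !invE.
have hP i := joinP ac cr i s1P s2P.
(* The four summands count the inversions (i, j) with i = a, those with j = c
   and i <> a, those of s1 and those of s2. *)
transitivity (\sum_(i < n) \sum_(j < n)
  ((i == a :> nat) * (a.+1 <= j < c.+1) + (a.+1 <= i < c) * (j == c :> nat)
   + ((i < j) && (s1 j < s1 i)) + ((i < j) && (s2 j < s2 i))))%N; last first.
  under eq_bigr do rewrite !big_split /=.
  rewrite !big_split /=; congr (_ + _ + _)%N.
  under eq_bigr do rewrite -big_distrr /=.
  rewrite -big_distrl /=.
  under [in X in (_ + X)%N]eq_bigr do rewrite -big_distrr /=.
  have cn := ltn_ord c.
  rewrite -big_distrl /= !sum_itv; [|lia..].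
  have one (b : 'I_n) : (\sum_(i < n) (i == b :> nat) = 1)%N.
    by rewrite (bigD1 b) //= eqxx big1 // => i /negPf; rewrite -val_eqE => ->.
  by rewrite !one; lia.
apply: eq_bigr => i _; apply: eq_bigr => j _.
case/ncinvolP: (s1P) => _ _ F1; case/ncinvolP: (s2P) => _ _ F2.
have s1a : s1 a = a by rewrite F1 //; lia.
have s1c : s1 c = c by rewrite F1 //; lia.
have s2a : s2 a = a by rewrite F2 //; lia.
have s2c : s2 c = c by rewrite F2 //; lia.
case: (hP i) => [[-> ->]|[-> ->]|[hi -> e hs]|[hi -> e [[_ hs]|[hs e']]]];
case: (hP j) => [[-> ->]|[-> ->]|[hj -> e1 ht]|[hj -> e1 [[_ ht]|[ht e1']]]];
rewrite ?mulnb ?s1a ?s1c ?s2a ?s2c ?e ?e' ?e1 ?e1';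
first [lia | move: (nat_of_ord (s1 i)) (nat_of_ord (s1 j))
                   (nat_of_ord (s2 i)) (nat_of_ord (s2 j)) hs ht; lia].
Qed.

(** * The recurrence for the inversion polynomials *)

Section Weight.
Variables (R : comNzRingType) (q : R).

Definition weight n l r : R := \sum_(s in ncinvol n l r) q ^+ Defs.inv s.

Lemma inv1 n : Defs.inv (1%g : 'S_n) = 0%N.
Proof.
by rewrite invE big1 // => i _; rewrite big1 // => j _; rewrite !perm1; lia.
Qed.

Lemma weight_nil n l : weight n l l = 1.
Proof. by rewrite /weight ncinvol_nil big_set1 inv1. Qed.

Lemma weight_fix n (a : 'I_n) r : (a < r)%N ->
  \sum_(s in ncinvol n a r | s a == a) q ^+ Defs.inv s = weight n a.+1 r.
Proof.
move=> ar; apply: eq_bigl => s.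
apply/andP/ncinvolP => [[/ncinvolP[sK nc sF] /eqP sa]|[sK nc sF]].
  split=> // i hi; case: (eqVneq i a) => [->//|]; rewrite -val_eqE /= => ia.
  by apply: sF; lia.
split; last by rewrite sF //; lia.
by apply/ncinvolP; split=> // i hi; apply: sF; lia.
Qed.

Lemma weight_arc n (a c : 'I_n) r : (a < c)%N -> (c < r)%N ->
  \sum_(s in ncinvol n a r | s a == c) q ^+ Defs.inv s =
  q ^+ (c - a.+1).*2.+1 * weight n a.+1 c * weight n c.+1 r.
Proof.
move=> ac cr; rewrite -mulrA /weight big_distrlr pair_big_dep /=.
rewrite (reindex_onto (join a c) (split_arc a c r)) /=; last first.
  by move=> s /andP[sP /eqP sa]; apply: split_arcK.
rewrite big_distrr /=; apply: congr_big => // [[s1 s2]|[s1 s2]] /=.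
  apply/idP/andP => [/andP[/andP[sP /eqP sa] /eqP E]|[s1P s2P]].
    by have := split_arc_ncinvol ac cr sP sa; rewrite E => /andP[].
  by have [-> ->] := joinK ac cr s1P s2P; rewrite join_ncinvol // !eqxx.
case/andP => /andP[sP /eqP sa] /eqP E.
have := split_arc_ncinvol ac cr sP sa; rewrite E => /andP[/= s1P s2P].
by rewrite (inv_join ac cr s1P s2P) !exprD mulrA.
Qed.

(** The two terms correspond to the first point l being fixed, or being joined
    to c. *)
Lemma weight_rec n l r : (l < r)%N -> (r <= n)%N ->
  weight n l r = weight n l.+1 r +
    \sum_(l.+1 <= c < r)
       q ^+ (c - l.+1).*2.+1 * weight n l.+1 c * weight n c.+1 r.
Proof.
move=> lr rn; have ln := leq_trans lr rn.
pose a := Ordinal ln.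
rewrite {1}/weight (partition_big (fun s : 'S_n => s a) xpredT) //=.
rewrite (bigD1 a) //= (@weight_fix _ a) //; congr (_ + _).
rewrite (big_nat_widenl _ 0) // (big_nat_widen _ _ n) //.
rewrite (big_mkord (fun c => _)) /=.
rewrite (bigID (fun c : 'I_n => (l < c < r)%N)) /= [X in _ + X]big1 ?addr0.
  apply: eq_big => c; first by rewrite -val_eqE /=; lia.
  by case/andP=> _ /andP[lc cr]; apply: (@weight_arc _ a).
move=> c /andP[ca hc]; apply: big1 => s /andP[sP /eqP sa].
have := @ncinvol_stable _ _ _ _ a sP; rewrite sa.
by move: ca; rewrite -val_eqE /=; lia.
Qed.

(** Translation invariance comes from the recurrence, whose exponents are
    differences of positions, rather than from conjugating by a translation,
    which would have to relate two symmetric groups. *)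
Lemma weight_shift n n' l l' d : (l + d <= n)%N -> (l' + d <= n')%N ->
  weight n l (l + d) = weight n' l' (l' + d).
Proof.
elim/ltn_ind: d => d IH in l l' *; case: d IH => [|d] IH ld ld'.
  by rewrite !addn0 !weight_nil.
rewrite (@weight_rec n l) ?(@weight_rec n' l'); [|lia..].
rewrite !addnS -!addSn; congr (_ + _); first by apply: IH; lia.
rewrite -[l.+1]add0n -[l'.+1]add0n !big_addn !add0n !addKn.
apply: eq_big_nat => i id.
rewrite ![(i + _)%N]addnC !addKn.
congr (_ * _ * _).
  by apply: IH; lia.
have -> : (l.+1 + d = (l.+1 + i).+1 + (d - i.+1))%N by lia.
have -> : (l'.+1 + d = (l'.+1 + i).+1 + (d - i.+1))%N by lia.
by apply: IH; lia.
Qed.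

Definition wt n := weight n 0 n.

Lemma weightE n l d : (l + d <= n)%N -> weight n l (l + d) = wt d.
Proof. by move=> ld; rewrite (@weight_shift _ d _ 0%N). Qed.

Lemma wt0 : wt 0 = 1. Proof. exact: weight_nil. Qed.

Lemma wtS n :
  wt n.+1 = wt n + \sum_(i < n) q ^+ i.*2.+1 * wt i * wt (n - i.+1).
Proof.
rewrite {1}/wt weight_rec // (@weightE _ 1 n) //; congr (_ + _).
rewrite big_add1 /= big_mkord; apply: eq_bigr => i _.
have := ltn_ord i => hi.
rewrite subSS subn0 (@weightE _ 1 i); last by lia.
have -> : n.+1 = (i.+2 + (n - i.+1))%N by lia.
by rewrite weightE //; lia.
Qed.

End Weight.

(** * The continued fraction *)

Section ContinuedFraction.
Variables (R : comUnitRingType) (q : R).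

Lemma fpsC_exp (c : R) k : fpsC c ^+ k = fpsC (c ^+ k).
Proof.
elim: k => [|k IHk]; first by rewrite !expr0.
rewrite !exprS IHk; apply: fpsP => n; rewrite coef_fpsCM /=.
by case: ifP => // _; rewrite mulr0.
Qed.

Let a n : fps R := fpsX R ^+ 2 * fpsC q ^+ (4 * n - 3).
Let b n : fps R := 1 - fpsX R * fpsC q ^+ (2 * n).

Lemma a_coef0 i : a i 0%N = 0.
Proof. by rewrite /a !coef_fps0M /= !mul0r. Qed.

Lemma b_coef0 i : b i 0%N = 1.
Proof.
by rewrite /b coef_fpsD coef_fpsN coef_fps0M /= mul0r subr0.
Qed.

Lemma denom_unit k j : cf_denom a b k j \is a GRing.unit.
Proof.
by apply: cf_denom_unit => i; rewrite ?a_coef0 // b_coef0 unitr1.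
Qed.

Lemma denom_coef0 k j : cf_denom a b k j 0%N = 1.
Proof.
case: k => [|k]; first exact: b_coef0.
rewrite [cf_denom _ _ _ _]/= coef_fpsD coef_fpsN coef_fps0M.
by rewrite a_coef0 b_coef0 mul0r subr0.
Qed.

(** This is u * (b_j - a_(j+1) * v) = 1, solved for the summand u: the factors
    x turn it into a recurrence on coefficients. *)
Lemma denom_inv_rec k j (u := (cf_denom a b k.+1 j)^-1)
    (v := (cf_denom a b k j.+1)^-1) :
  u = 1 + fpsX R * (fpsC (q ^+ j.*2) * u
                    + fpsX R * (fpsC (q ^+ (4 * j).+1) * (v * u))).
Proof.
have : u * cf_denom a b k.+1 j = 1 by rewrite mulVr ?denom_unit.
rewrite /= -/v /a /b !fpsC_exp mul2n.
have -> : (4 * j.+1 - 3 = (4 * j).+1)%N by lia.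
move=> E; rewrite -[in RHS]E; ring.
Qed.

(** The inverse of the k-step denominator at level j agrees with F_j up to
    degree k.  Passing to level j + 1 uses up one step of the fraction but
    lowers the degree by at least two, so the bound is preserved. *)
Lemma coef_denom_inv n k j : (n <= k)%N ->
  (cf_denom a b k j)^-1 n = q ^+ (j.*2 * n) * wt q n.
Proof.
elim/ltn_ind: n => -[|n] IH in k j * => le_nk.
  have := congr1 (fun f : fps R => f 0%N) (mulVr (denom_unit k j)).
  by rewrite coef_fps0M coef_fps1 denom_coef0 mulr1 muln0 wt0 mulr1.
case: k le_nk => // k le_nk.
rewrite denom_inv_rec coef_fpsD coef_fps1 add0r coef_fpsXM.
rewrite coef_fpsD coef_fpsCM IH //; last exact: leqW.
rewrite wtS mulrDr; congr (_ + _).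
  by rewrite mulrA -exprD mulnS.
rewrite coef_fpsXM mulr_sumr.
case: n => [|n] in IH le_nk *; first by rewrite big_ord0.
rewrite coef_fpsCM coef_fpsM mulr_sumr; apply: eq_bigr => i _.
have := ltn_ord i => hi.
rewrite !IH; try lia.
rewrite subSS.
transitivity (q ^+ ((4 * j).+1 + j.+1.*2 * i + j.*2 * (n - i)) *
              wt q i * wt q (n - i)).
  by rewrite !exprD; ring.
transitivity (q ^+ (j.*2 * n.+2 + i.*2.+1) * wt q i * wt q (n - i)).
  by congr (q ^+ _ * _ * _); nia.
by rewrite exprD; ring.
Qed.

End ContinuedFraction.

Theorem corollary3p5 :
  Zqx_cvg (cf_convergent (fun n : nat => xvar ^+ 2 * qvar ^+ (4 * n - 3))
                         (fun n : nat => 1 - xvar * qvar ^+ (2 * n)))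
          I3412_gf.
Proof.
move=> n m; exists n => k le_nk.
rewrite /cf_convergent div1r (coef_denom_inv (fpsX int) 0) //.
by rewrite double0 mul0n expr0 mul1r /I3412_gf /= I3412_ncinvol.
Qed.
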